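(* Let $A$ be a unital $C^*$-algebra and let $D^{\bullet}=(D_i,\Gamma^i)_{i\in\mathbb{N}_0}$ be a parametrix possessing complex of pre-Hilbert $A$-modules and adjointable pre-Hilbert $A$-module homomorphisms $D_i:\Gamma^i\to\Gamma^{i+1}$. Then for each $i\in\mathbb{N}_0$, $$H^i(D,A)\simeq K^i(D,A)\quad\text{as } A\text{-modules},$$ where $H^i(D,A)=\mathrm{Ker}(D_i:\Gamma^i\to\Gamma^{i+1})/\mathrm{Rng}(D_{i-1}:\Gamma^{i-1}\to\Gamma^i)$ and $K^i(D,A)=\mathrm{Ker}(\triangle_i:\Gamma^i\to\Gamma^i)$ with $\triangle_i=D_{i-1}D_{i-1}^*+D_i^*D_i$.
   Context: A pre-Hilbert $A$-module is a left $A$-module $U$ with a positive definite $A$-sesquilinear map $(\cdot,\cdot)_U:U\times U\to A$ (conjugate linear in the first variable), with norm $|u|_U=\sqrt{|(u,u)_U|_A}$. $\mathrm{Hom}_A(U,V)$ denotes the continuous $A$-module homomorphisms, called pre-Hilbert $A$-module homomorphisms; adjoints are with respect to the $A$-valued products. Objects with index out of range are zero, in particular $D_{-1}=0$. A complex $D^{\bullet}=(D_i,\Gamma^i)_{i\in\mathbb{N}_0}$ (so $D_{i+1}D_i=0$) of pre-Hilbert $A$-modules and adjointable pre-Hilbert $A$-module homomorphisms is called parametrix possessing if for each $i\in\mathbb{N}_0$ there exist $g_i,p_i\in\mathrm{Hom}_A(\Gamma^i,\Gamma^i)$ such that $1_{|\Gamma^i}=g_i\triangle_i+p_i$, $1_{|\Gamma^i}=\triangle_ig_i+p_i$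 and $\triangle_ip_i=0$. The cohomology groups carry the quotient $A$-module structure. *)

(* Defs.v *)
(* The complex numbers are R[i] for R : realType. *)
From HB Require Import structures.
From mathcomp Require Import all_boot all_order all_algebra.
From mathcomp Require Import ring_quotient.
From mathcomp.real_closed Require Import complex.
From mathcomp Require Import boolp classical_sets reals.

Set Implicit Arguments.
Unset Strict Implicit.
Unset Printing Implicit Defensive.

Import Order.TTheory GRing.Theory Num.Theory.
Import ComplexField.Normc.

Local Open Scope ring_scope.
Local Open Scope complex_scope.
Local Open Scope quotient_scope.
Local Open Scope classical_set_scope.

(* The norm is a field of the structure: numDomainType already extends both the
   rings and the normed Z-modules of the hierarchy, which precludes a second
   join of the two. *)
HB.mixin Record Algebra_isCStar (R : realType) A of GRing.Algebra R[i] A := {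
  cnorm : A -> R ;
  cnormD : forall a b : A, cnorm (a + b) <= cnorm a + cnorm b ;
  cnormZ : forall (z : R[i]) (a : A), cnorm (z *: a) = normc z * cnorm a ;
  cnorm_eq0 : forall a : A, cnorm a = 0 -> a = 0 ;
  cnormM : forall a b : A, cnorm (a * b) <= cnorm a * cnorm b ;
  cnorm_complete : forall s : nat -> A,
    (forall e : R, 0 < e -> exists N : nat, forall m n : nat,
       (N <= m)%N -> (N <= n)%N -> cnorm (s m - s n) < e) ->
    exists l : A, forall e : R, 0 < e -> exists N : nat, forall n : nat,
       (N <= n)%N -> cnorm (s n - l) < e ;
  star : A -> A ;
  starD : {morph star : a b / a + b} ;
  starZ : forall (z : R[i]) (a : A), star (z *: a) = z^* *: star a ;
  starM : forall a b : A, star (a * b) = star b * star a ;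
  starK : involutive star ;
  cnorm_star : forall a : A, cnorm (star a * a) = cnorm a ^+ 2 }.

#[short(type="cstarAlgType")]
HB.structure Definition CStarAlgebra (R : realType) :=
  {A of GRing.Algebra R[i] A & Algebra_isCStar R A}.

Section CStarAlgebraTheory.
Context {R : realType} {A : cstarAlgType R}.
Implicit Types a : A.

Definition invertible a := exists b : A, a * b = 1 /\ b * a = 1.

Definition spectrum a : set R[i] := [set z | ~ invertible (a - z%:A)].

Definition cstar_positive a :=
  star a = a /\ spectrum a `<=` [set z | 0 <= z].

Lemma star1 : star (1 : A) = 1.
Proof. by have := starM (star 1) (1 : A); rewrite mulr1 !starK mulr1. Qed.

End CStarAlgebraTheory.

(* U is a left A-module and the product is conjugate linear in the first
   variable; associativity of the action then forces star a to act on the right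
   of the product.  The complex structure of U is z *: u := z%:A *: u, so that
   complex sesquilinearity is a special case.  Hermitian symmetry follows from
   positivity by polarization (inner_star below). *)
HB.mixin Record Lmodule_isPreHilbert (R : realType) (A : cstarAlgType R) U
    of GRing.Lmodule A U := {
  inner : U -> U -> A ;
  innerDl : forall u v w : U, inner (u + v) w = inner u w + inner v w ;
  innerDr : forall u v w : U, inner u (v + w) = inner u v + inner u w ;
  innerZl : forall (a : A) (u v : U), inner (a *: u) v = inner u v * star a ;
  innerZr : forall (a : A) (u v : U), inner u (a *: v) = a * inner u v ;
  inner_positive : forall u : U, cstar_positive (inner u u) ;
  inner_definite : forall u : U, inner u u = 0 -> u = 0 }.

#[short(type="preHilbertType")]
HB.structure Definition PreHilbert (R : realType) (A : cstarAlgType R) :=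
  {U of GRing.Lmodule A U & Lmodule_isPreHilbert R A U}.

Section PreHilbertModules.
Context {R : realType} {A : cstarAlgType R}.
Implicit Types U V : preHilbertType A.

Lemma inner_star U (u v : U) : star (inner u v) = inner v u.
Proof.
have sa (w : U) : star (inner w w) = inner w w by have [] := inner_positive w.
have i_neq0 : 'i%C != 0 :> R[i] by rewrite eq_complex/= eqxx oner_eq0.
set x := inner u v; set y := inner v u.
have h1 : star x + star y = x + y.
  have := sa (u + v); rewrite !innerDl !innerDr !starD !sa -/x -/y.
  rewrite -!addrA => /addrI; rewrite !addrA => /addIr.
  by [].
have h2 : star x - star y = y - x.
  have := sa (u + 'i%:A *: v).
  rewrite !innerDl !innerDr !innerZl !innerZr !starD !starM !starK !sa -/x -/y.
  rewrite !starZ !star1 -!scalerAl -!scalerAr !mul1r !mulr1.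
  rewrite -!addrA => /addrI; rewrite !addrA => /addIr.
  have -> : Num.conj 'i%C = - 'i%C :> R[i].
    by apply/eqP; rewrite eq_complex/= oppr0 !eqxx.
  rewrite !scaleNr [- _ + _]addrC -!scalerBr => /(scalerI i_neq0) e.
  by rewrite -opprB e opprB.
have /eqP := congr2 +%R h1 h2.
rewrite addrACA subrr addr0 [x + y]addrC addrACA subrr addr0 -!mulr2n.
rewrite -subr_eq0 -mulrnBl -scaler_nat scaler_eq0 pnatr_eq0 subr_eq0.
by move/eqP.
Qed.

Definition mod_norm U (u : U) : R := Num.sqrt (cnorm (inner u u)).

(* Continuity for the metrics |u - v|_U and |x - y|_V. *)
Definition mod_continuous U V (f : U -> V) :=
  forall (u : U) (e : R), 0 < e ->
    exists2 d : R, 0 < d &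
      forall v : U, mod_norm (v - u) < d -> mod_norm (f v - f u) < e.

Record prehilbert_hom U V := PreHilbertHom {
  hom_linear :> {linear U -> V} ;
  hom_continuous : mod_continuous hom_linear }.

Definition adjointable U V (f : U -> V) :=
  exists g : V -> U, forall u v, inner (f u) v = inner u (g v).

Definition adjoint U V (f : U -> V) (hf : adjointable f) : V -> U :=
  projT1 (cid hf).

Lemma adjointP U V (f : U -> V) (hf : adjointable f) u v :
  inner (f u) v = inner u (adjoint hf v).
Proof. exact: (projT2 (cid hf)). Qed.

Lemma inner_injr U (v w : U) : (forall u, inner u v = inner u w) -> v = w.
Proof.
move=> h; apply/eqP; rewrite -subr_eq0; apply/eqP/inner_definite.
rewrite -[X in inner _ (_ + X)]scaleN1r innerDr innerZr mulN1r h subrr.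
by [].
Qed.

Fact adjoint_is_linear U V (f : U -> V) (hf : adjointable f) :
  linear (adjoint hf).
Proof.
by move=> a v w; apply: inner_injr => u;
   rewrite -adjointP !innerDr !innerZr -!adjointP.
Qed.

HB.instance Definition _ U V (f : U -> V) (hf : adjointable f) :=
  GRing.isLinear.Build A V U *:%R (adjoint hf) (adjoint_is_linear hf).

End PreHilbertModules.

Section Kernel.
Context {K : pzRingType} {U V : lmodType K}.
Variable f : {linear U -> V}.

Definition ker_pred : {pred U} := fun u => f u == 0.

Fact ker_pred_submod : subsemimod_closed ker_pred.
Proof.
split; first split.
- by rewrite unfold_in linear0.
- by move=> u v /eqP fu /eqP fv; rewrite unfold_in linearD fu fv addr0.
- by move=> a u /eqP fu; rewrite unfold_in linearZ/= fu scaler0.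
Qed.

HB.instance Definition _ := GRing.isSubmodClosed.Build K U ker_pred ker_pred_submod.

Definition Ker := {u : U | u \in ker_pred}.

HB.instance Definition _ := SubChoice.on Ker.
HB.instance Definition _ := [SubChoice_isSubLmodule of Ker by <:].

End Kernel.

(* Extends to modules the quotient of an abelian group in ring_quotient. *)
Section QuotientModule.
Context {K : pzRingType} {V : lmodType K}.
Variable S : submodClosed V.

(* submodClosed does not record the closure under opposites that the quotient of
   the underlying group asks for. *)
Definition subgroup_pred : {pred V} := fun v => v \in S.

Fact subgroup_pred_closed : zmod_closed subgroup_pred.
Proof.
split=> [|u v uS vS]; first exact: rpred0.
by rewrite unfold_in -scaleN1r rpredD ?rpredZ.
Qed.

HB.instance Definition _ :=
  GRing.isZmodClosed.Build V subgroup_pred subgroup_pred_closed.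

Definition quot_module : Type := Quotient.quot subgroup_pred.

HB.instance Definition _ := GRing.Zmodule.on quot_module.

Definition quot_scale (a : K) (x : quot_module) : quot_module :=
  \pi_(Quotient.quot subgroup_pred) (a *: repr (x : Quotient.quot subgroup_pred)).

Lemma quot_scale_pi a v :
  quot_scale a (\pi_(Quotient.quot subgroup_pred) v) = \pi_(Quotient.quot subgroup_pred) (a *: v).
Proof.
apply/eqP; rewrite /quot_scale -Quotient.idealrBE -scalerBr.
rewrite unfold_in rpredZ// -[_ \in S]/(_ \in subgroup_pred).
by rewrite Quotient.idealrBE reprK.
Qed.

Fact quot_scaleA a b x : quot_scale a (quot_scale b x) = quot_scale (a * b) x.
Proof.
by rewrite -[x](@reprK _ (Quotient.quot subgroup_pred)) !quot_scale_pi scalerA.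
Qed.

Fact quot_scale1 : left_id 1 quot_scale.
Proof.
by move=> x; rewrite -[x](@reprK _ (Quotient.quot subgroup_pred)) quot_scale_pi scale1r.
Qed.

Lemma quot_piD u v :
  \pi_(Quotient.quot subgroup_pred) u + \pi_(Quotient.quot subgroup_pred) v
  = \pi_(Quotient.quot subgroup_pred) (u + v) :> quot_module.
Proof. by rewrite [RHS]Quotient.pi_add. Qed.

Fact quot_scaleDr : right_distributive quot_scale +%R.
Proof.
move=> a x y.
rewrite -[x](@reprK _ (Quotient.quot subgroup_pred)).
rewrite -[y](@reprK _ (Quotient.quot subgroup_pred)).
by rewrite quot_piD !quot_scale_pi quot_piD scalerDr.
Qed.

Fact quot_scaleDl x : {morph quot_scale^~ x : a b / a + b}.
Proof.
move=> a b; rewrite -[x](@reprK _ (Quotient.quot subgroup_pred)).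
by rewrite !quot_scale_pi scalerDl quot_piD.
Qed.

HB.instance Definition _ := GRing.Zmodule_isLmodule.Build K quot_module
  quot_scaleA quot_scale1 quot_scaleDr quot_scaleDl.

End QuotientModule.

Record prehilbert_complex (R : realType) (A : cstarAlgType R) :=
  PreHilbertComplex {
    cmod :> nat -> preHilbertType A ;
    cdiff : forall i, prehilbert_hom (cmod i) (cmod i.+1) ;
    cdiff_adjointable : forall i, adjointable (cdiff i) ;
    cdiff_cdiff : forall i (u : cmod i), cdiff i.+1 (cdiff i u) = 0 }.

Section Cohomology.
Context {R : realType} {A : cstarAlgType R}.
Variable D : prehilbert_complex A.

Definition cdiff_adj i : {linear D i.+1 -> D i} :=
  adjoint (@cdiff_adjointable R A D i).

(* D_{i-1} D_{i-1}^*, with D_{-1} = 0. *)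
Definition cdiff_cdiff_adj i : {linear D i -> D i} :=
  match i return {linear D i -> D i} with
  | 0 => \0
  | j.+1 => cdiff D j \o cdiff_adj j
  end.

Definition laplacian i : {linear D i -> D i} :=
  cdiff_cdiff_adj i \+ (cdiff_adj i \o cdiff D i).

(* The range of D_{i-1}, with D_{-1} = 0. *)
Definition rng_prev i : set (D i) :=
  match i return set (D i) with
  | 0 => [set 0]
  | j.+1 => range (cdiff D j)
  end.

(* The range of D_{i-1} as a submodule of Ker D_i. *)
Definition boundary i : {pred Ker (cdiff D i)} :=
  fun u => `[< rng_prev (val u) >].

Fact boundary_submod i : subsemimod_closed (@boundary i).
Proof.
rewrite /boundary; case: i => [|j].
  split; first split.
  - by apply/asboolP.
  - by move=> u v /asboolP/= u0 /asboolP/= v0; apply/asboolP; rewrite /= u0 v0 addr0.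
  - by move=> a u /asboolP/= u0; apply/asboolP; rewrite /= u0 scaler0.
split; first split.
- by apply/asboolP; exists 0 => //; rewrite linear0.
- move=> u v /asboolP[x _ xu] /asboolP[y _ yv]; apply/asboolP.
  by exists (x + y) => //; rewrite linearD/= xu yv.
- move=> a u /asboolP[x _ xu]; apply/asboolP.
  by exists (a *: x) => //; rewrite linearZ/= xu.
Qed.

HB.instance Definition _ i :=
  GRing.isSubmodClosed.Build A (Ker (cdiff D i)) (@boundary i) (@boundary_submod i).

Definition cohomology i : lmodType A := quot_module (@boundary i).

Definition harmonic i : lmodType A := Ker (laplacian i).

Definition parametrix_possessing :=
  forall i, exists g p : prehilbert_hom (D i) (D i),
    [/\ forall u, u = g (laplacian i u) + p u,
        forall u, u = laplacian i (g u) + p u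
      & forall u, laplacian i (p u) = 0].

End Cohomology.

Definition lmod_isomorphic (K : pzRingType) (V W : lmodType K) :=
  exists f : {linear V -> W}, bijective f.

(* Main.v *)
Require Import Defs.
From mathcomp Require Import all_boot all_algebra reals.
From HB Require Import structures.
From mathcomp Require Import boolp classical_sets.

(** Every harmonic element is closed, so the inclusion of [harmonic D i] into
    [Ker (cdiff D i)] induces a linear map to cohomology ([harmonic_class]); it
    is shown to be bijective.

    The basic tool is that an adjointable [f] satisfies [f^* f u = 0 -> f u = 0]
    and [f f^* v = 0 -> f^* v = 0], by definiteness of the products.  Since
    [D_i D_(i-1) = 0], the summand [D_(i-1) D_(i-1)^*] of the Laplacian takes
    values in [Ker D_i]; hence if [D_i] kills [laplacian D i u], then
    [D_i D_i^* D_i u = 0], and the tool applied twice gives [D_i u = 0]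
    ([cdiff_laplacian_eq0]).

    Injectivity: a harmonic [D_(i-1) x] satisfies
    [D_(i-1) D_(i-1)^* D_(i-1) x = 0], and the tool applied twice again gives
    [D_(i-1) x = 0] ([harmonic_boundary_eq0]).

    Surjectivity: a closed [u] is [laplacian (g u) + p u] with [p u] harmonic,
    hence closed.  So [laplacian (g u)] is closed, and therefore equal to
    [D_(i-1) D_(i-1)^* (g u)], a boundary: [u] and [p u] have the same class. *)

Set Implicit Arguments.
Unset Strict Implicit.
Unset Printing Implicit Defensive.

Import GRing.Theory.

Local Open Scope ring_scope.
Local Open Scope quotient_scope.
Local Open Scope classical_set_scope.

Section Adjoint.
Context {R : realType} {A : cstarAlgType R}.
Implicit Types U V : preHilbertType A.

Lemma inner0l U (u : U) : inner 0 u = 0.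
Proof. by apply: (addrI (inner 0 u)); rewrite -innerDl !addr0. Qed.

Lemma inner0r U (u : U) : inner u 0 = 0.
Proof. by apply: (addrI (inner u 0)); rewrite -innerDr !addr0. Qed.

(** [(f u, f u) = (u, f^* f u)], and the product is definite. *)
Lemma adjoint_comp_eq0 U V (f : U -> V) (hf : adjointable f) (u : U) :
  adjoint hf (f u) = 0 -> f u = 0.
Proof. by move=> h; apply: inner_definite; rewrite (adjointP hf) h inner0r. Qed.

(** [(f^* v, f^* v) = (f f^* v, v)], and the product is definite. *)
Lemma comp_adjoint_eq0 U V (f : U -> V) (hf : adjointable f) (v : V) :
  f (adjoint hf v) = 0 -> adjoint hf v = 0.
Proof. by move=> h; apply: inner_definite; rewrite -adjointP h inner0l. Qed.

End Adjoint.

Lemma bijective_linear_isomorphic (K : pzRingType) (V W : lmodType K)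
    (f : {linear V -> W}) : bijective f -> lmod_isomorphic W V.
Proof.
case=> g fK gK.
pose gL := GRing.isLinear.Build K W V *:%R g (can2_linear fK gK).
pose G : {linear W -> V} := HB.pack g gL.
by exists G; exists f.
Qed.

Section QuotientProjection.
Context {K : pzRingType} {V : lmodType K} (S : submodClosed V).

Definition quot_proj (v : V) : quot_module S :=
  \pi_(Quotient.quot (subgroup_pred S)) v.

Fact quot_proj_linear : linear quot_proj.
Proof. by move=> a u v; rewrite /quot_proj -quot_piD -quot_scale_pi. Qed.

HB.instance Definition _ :=
  GRing.isLinear.Build K V (quot_module S) *:%R quot_proj quot_proj_linear.

Lemma quot_proj_eq u v : (quot_proj u == quot_proj v) = (u - v \in S).
Proof. by rewrite /quot_proj -Quotient.idealrBE. Qed.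

Lemma quot_proj_surj x : exists v, quot_proj v = x.
Proof. by exists (repr x); rewrite /quot_proj reprK. Qed.

End QuotientProjection.

Section Harmonic.
Context {R : realType} {A : cstarAlgType R} (D : prehilbert_complex A) (i : nat).

Lemma laplacianE (u : D i) :
  laplacian D i u = cdiff_cdiff_adj D i u + cdiff_adj D i (cdiff D i u).
Proof. by []. Qed.

Lemma cdiff_cdiff_adj_rng (u : D i) : rng_prev (cdiff_cdiff_adj D i u).
Proof. by case: i u => [|j] u //=; exists (cdiff_adj D j u). Qed.

Lemma cdiff_rng_prev (u : D i) : rng_prev u -> cdiff D i u = 0.
Proof.
by case: i u => [|j] u /=; [move=> -> /[!linear0] | case=> x _ <-; exact: cdiff_cdiff].
Qed.

(** As [D_i] kills the range of [D_(i-1)], the hypothesis reduces to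
    [D_i D_i^* D_i u = 0], from which the outer [D_i] and then [D_i^*] can be
    cancelled.  With [laplacian D i u = 0] this gives one half of the equality
    of the harmonic elements with [Ker D_i] intersected with
    [Ker D_(i-1)^*]; in the form stated it also applies to the potential
    [g u] of a closed element. *)
Lemma cdiff_laplacian_eq0 (u : D i) :
  cdiff D i (laplacian D i u) = 0 -> cdiff D i u = 0.
Proof.
rewrite laplacianE linearD (cdiff_rng_prev (cdiff_cdiff_adj_rng u)) add0r => h.
exact/(@adjoint_comp_eq0 _ _ _ _ _ (cdiff_adjointable D i))/comp_adjoint_eq0.
Qed.

Lemma harmonic_closed (u : D i) : laplacian D i u = 0 -> cdiff D i u = 0.
Proof. by move=> h; apply: cdiff_laplacian_eq0; rewrite h linear0. Qed.

Lemma closed_laplacianE (u : D i) :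
  cdiff D i u = 0 -> laplacian D i u = cdiff_cdiff_adj D i u.
Proof. by move=> h; rewrite laplacianE h linear0 addr0. Qed.

(** A harmonic element is closed, so the Laplacian reduces on it to
    [D_(i-1) D_(i-1)^*]; on [u = D_(i-1) x] the vanishing of
    [D_(i-1) D_(i-1)^* D_(i-1) x] then cancels down to that of [u]. *)
Lemma harmonic_boundary_eq0 (u : D i) :
  laplacian D i u = 0 -> rng_prev u -> u = 0.
Proof.
move=> hu ru; have := closed_laplacianE (harmonic_closed hu); rewrite hu.
case: i u ru {hu} => [|j] u /=; first by move=> ->.
case=> x _ <- /esym h.
exact/(@adjoint_comp_eq0 _ _ _ _ _ (cdiff_adjointable D j))/comp_adjoint_eq0.
Qed.

Fact harmonic_in_ker (u : harmonic D i) : val u \in ker_pred (cdiff D i).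
Proof. by apply/eqP/harmonic_closed/eqP; exact: (valP u). Qed.

Definition harmonic_cocycle (u : harmonic D i) : Ker (cdiff D i) :=
  Sub (val u) (harmonic_in_ker u).

Definition harmonic_class (u : harmonic D i) : cohomology D i :=
  quot_proj (@boundary R A D i) (harmonic_cocycle u).

Fact harmonic_class_linear : linear harmonic_class.
Proof.
move=> a u v; rewrite /harmonic_class -linearP; congr quot_proj.
exact: val_inj.
Qed.

HB.instance Definition _ := GRing.isLinear.Build A (harmonic D i)
  (cohomology D i) *:%R harmonic_class harmonic_class_linear.

Lemma harmonic_class_inj : injective harmonic_class.
Proof.
move=> u v /eqP; rewrite quot_proj_eq => /asboolP /= h.
apply/eqP; rewrite -subr_eq0; apply/eqP/val_inj.
by apply: harmonic_boundary_eq0 => //; apply/eqP; exact: (valP (u - v)).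
Qed.

(** The harmonic representative of the class of [u] is [p u]: the difference
    [u - p u = laplacian (g u)] is closed, so [g u] is closed, and the
    Laplacian takes it to a boundary. *)
Lemma harmonic_class_surj (hD : parametrix_possessing D) (x : cohomology D i) :
  exists u, harmonic_class u = x.
Proof.
have [u <-] := quot_proj_surj x.
have [g [p [_ u_eq p_harm]]] := hD i.
have pu : p (val u) \in ker_pred (laplacian D i) by exact/eqP/p_harm.
exists (Sub (p (val u)) pu); apply/esym/eqP; rewrite quot_proj_eq.
apply/asboolP => /=.
have uE : val u - p (val u) = laplacian D i (g (val u)).
  by rewrite {1}(u_eq (val u)) addrK.
rewrite uE closed_laplacianE; first exact: cdiff_cdiff_adj_rng.
apply: cdiff_laplacian_eq0; rewrite -uE linearB (harmonic_closed (p_harm _)).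
by rewrite subr0; apply/eqP; exact: (valP u).
Qed.

End Harmonic.

Theorem theorem4 (R : realType) (A : cstarAlgType R) (D : prehilbert_complex A)
    (hD : parametrix_possessing D) (i : nat) :
  lmod_isomorphic (cohomology D i) (harmonic D i).
Proof.
have [g gK] := choice (@harmonic_class_surj R A D i hD).
apply: (@bijective_linear_isomorphic _ _ _ (@harmonic_class R A D i)).
by exists g => // u; apply: (@harmonic_class_inj R A D i); rewrite gK.
Qed.
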